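(* Let $G$ be a countable discrete group, $m$ a probability measure on $G$, and $(X,\mu)$ a standard probability space. If $a,b\in\mathrm{Stat}(G,m,X,\mu)$ are weakly equivalent ($a\sim b$), then their Furstenberg entropies coincide: $h_m(X,\mu,a)=h_m(X,\mu,b)$.
   Context: A measurable action $a$ of $G$ on $(X,\mu)$ is $m$-stationary if $\sum_{g\in G} m(g)\,\mu(g^aA)=\mu(A)$ for every measurable $A\subseteq X$, where $g^a$ denotes the (nonsingular) transformation by which $g$ acts in $a$. $\mathrm{Stat}(G,m,X,\mu)$ is the set of such actions. For $a,b\in\mathrm{Stat}(G,m,X,\mu)$, $a\preceq b$ means: for every $\epsilon>0$, finite $F\subseteq G$ and measurable $A_1,\ldots,A_n\subseteq X$ there are measurable $B_1,\ldots,B_n\subseteq X$ with $|\mu(g^aA_i\cap A_j)-\mu(g^bB_i\cap B_j)|<\epsilon$ for all $g\in F$, $i,j\le n$; and $a\sim b$ means $a\preceq b$ and $b\preceq a$. For $g\in G$ let $g^a\mu$ denote the measure $A\mapsto\mu(g^aA)$ (absolutely continuous w.r.t. $\mu$). The Furstenberg entropy is $h_m(X,\mu,a)=-\sum_{g\in G}m(g)\int_X\log\frac{d g^a\mu}{d\mu}(x)\,d\mu(x)\in[0,\infty]$. *)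

(* Defs.v *)
From HB Require Import structures.
From mathcomp Require Import all_boot all_order all_algebra.
From mathcomp Require Import all_classical all_reals all_analysis.

Set Implicit Arguments.
Unset Strict Implicit.
Unset Printing Implicit Defensive.

Import Order.TTheory GRing.Theory Num.Theory.
Import numFieldNormedType.Exports.

Local Open Scope classical_set_scope.
Local Open Scope ring_scope.

(* Standard Borel spaces.  By Kuratowski's theorem a measurable space is
   standard Borel iff it is Borel isomorphic to a Borel subset of R; we
   use this form (Polish spaces are not available in the library).     *)
Definition standard_borel (R : realType) d (X : measurableType d) : Prop :=
  exists f : X -> R,
    [/\ injective f, measurable_fun [set: X] f, measurable (range f)
      & forall A : set X, measurable A -> measurable (f @` A)].

Record mact (G : groupType) d (X : measurableType d) := MAct {
  act :> G -> X -> X ;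
  act_meas : forall g, measurable_fun [set: X] (act g) ;
  act1 : forall x, act 1%g x = x ;
  actM : forall g h x, act (g * h)%g x = act g (act h x) }.

Section mact_lemmas.
Variables (G : groupType) (d : measure_display) (X : measurableType d).
Variable a : mact G X.

Lemma act_image_preimage (g : G) (A : set X) :
  a g @` A = a (g^-1)%g @^-1` A.
Proof.
apply/seteqP; split => x /=.
  by move=> [y Ay <-]; rewrite -actM mulVg act1.
by move=> Ax; exists (a (g^-1)%g x) => //; rewrite -actM mulgV act1.
Qed.

Lemma measurable_act_image (g : G) (A : set X) :
  measurable A -> measurable (a g @` A).
Proof.
move=> mA; rewrite act_image_preimage -[X in measurable X]setTI.
exact: act_meas.
Qed.

End mact_lemmas.

Section translate_measure.
Local Open Scope ereal_scope.
Variables (G : groupType) (d : measure_display) (X : measurableType d).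
Variables (R : realType) (mu : probability X R) (a : mact G X) (g : G).

Definition gmu : set X -> \bar R := fun A => mu (a g @` A).

Let gmu0 : gmu set0 = 0.
Proof. by rewrite /gmu image_set0 measure0. Qed.

Let gmu_finite A : measurable A -> gmu A \is a fin_num.
Proof. by move=> mA; apply: fin_num_measure; exact: measurable_act_image. Qed.

Let gmu_sigma_additive : semi_sigma_additive gmu.
Proof.
move=> F mF tF mUF; rewrite /gmu act_image_preimage preimage_bigcup.
under eq_fun do under eq_bigr do rewrite act_image_preimage.
apply: measure_semi_sigma_additive.
- by move=> n; rewrite -[X in measurable X]setTI; exact: act_meas.
- apply/trivIsetP => /= i j _ _ ij; rewrite -preimage_setI.
  by move/trivIsetP : tF => /(_ _ _ _ _ ij) ->//; rewrite preimage_set0.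
- by rewrite -preimage_bigcup -[X in measurable X]setTI; exact: act_meas.
Qed.

HB.instance Definition _ := isCharge.Build _ _ _ gmu
  gmu0 gmu_finite gmu_sigma_additive.

End translate_measure.

Definition prob_on (R : realType) (G : choiceType) (m : G -> R) : Prop :=
  (forall g, 0 <= m g) /\ (\esum_(g in [set: G]) (m g)%:E = 1)%E.

Definition stationary (G : groupType) (R : realType) (m : G -> R)
    d (X : measurableType d) (mu : probability X R) (a : mact G X) : Prop :=
  (forall g (A : set X), measurable A ->
      (mu (a g @` A) = 0 <-> mu A = 0)%E) /\
  (forall A : set X, measurable A ->
      (\esum_(g in [set: G]) ((m g)%:E * mu (a g @` A)) = mu A)%E).

Definition weakly_contained (G : groupType) (R : realType)
    d (X : measurableType d) (mu : probability X R) (a b : mact G X) : Prop :=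
  forall (eps : R), 0 < eps ->
  forall (F : seq G) (n : nat) (A : 'I_n -> set X),
    (forall i, measurable (A i)) ->
    exists B : 'I_n -> set X,
      (forall i, measurable (B i)) /\
      forall g i j, g \in F ->
        (`| mu (a g @` A i `&` A j) - mu (b g @` B i `&` B j) | < eps%:E)%E.

Definition weakly_equiv (G : groupType) (R : realType)
    d (X : measurableType d) (mu : probability X R) (a b : mact G X) : Prop :=
  weakly_contained mu a b /\ weakly_contained mu b a.

(* Furstenberg entropy
   h_m(X, mu, a) = - sum_g m(g) \int log (d g^a mu / d mu) d mu,
   written as sum_g m(g) * ( - \int log (d g^a mu / d mu) d mu ). *)
Definition furstenberg_entropy (G : groupType) (R : realType) (m : G -> R)
    d (X : measurableType d) (mu : probability X R) (a : mact G X) : \bar R :=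
  (\esum_(g in [set: G])
     ((m g)%:E *
      - \int[mu]_(x in [set: X])
          (ln (fine (Radon_Nikodym (gmu mu a g) mu x)))%:E))%E.

(* Main.v *)
Require Import Defs.
From HB Require Import structures.
From mathcomp Require Import all_boot all_order all_algebra.
From mathcomp Require Import all_classical all_reals all_analysis.
From mathcomp Require Import measurable_realfun lra.

Import Order.TTheory GRing.Theory Num.Theory.
Import numFieldNormedType.Exports.

(* For each g the density f = d(g^a mu)/d mu enters the entropy only through
   its law under mu, and this law is determined by the set of pairs
   (mu A, mu (g^a A)).  Indeed E(t) = sup_A (t mu A - mu (g^a A)) is attained
   at A = {f <= t}, and comparing the maximisers at s and t gives
   (t - s) mu {f <= s} <= E(t) - E(s) <= (t - s) mu {f <= t} for s < t, so E
   determines the distribution function of f.  Weak containment, applied to A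
   together with the whole space, yields E_a <= E_b.  Single sets suffice: no
   almost partition has to be repaired. *)

Local Open Scope classical_set_scope.
Local Open Scope ring_scope.

(** * The law of an integrable function from its integrals over sets *)

Section equality_in_law.
Context d (X : measurableType d) (R : realType) (mu : probability X R).

Lemma preimage_itvNyc (f : X -> R) (t : R) :
  f @^-1` `]-oo, t] = [set x | f x <= t].
Proof. by apply/seteqP; split => x /=; rewrite in_itv. Qed.

Lemma measurable_sublevel (f : X -> R) (t : R) :
  measurable_fun [set: X] f -> measurable [set x | f x <= t].
Proof.
by move=> mf; rewrite -preimage_itvNyc -[X in measurable X]setTI; exact: mf.
Qed.

Lemma integrable_measurable (f : X -> R) :
  mu.-integrable [set: X] (EFin \o f) -> measurable_fun [set: X] f.
Proof. by move=> /measurable_int/measurable_EFinP. Qed.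

(** For the density f of g^a mu this is the quantity t mu A - mu (g^a A) whose supremum over A is
    E(t). *)
Definition gain (f : X -> R) (t : R) (A : set X) : R :=
  t * fine (mu A) - \int[mu]_(x in A) f x.

Lemma gainE (f : X -> R) (t : R) (A : set X) :
  mu.-integrable [set: X] (EFin \o f) -> measurable A ->
  gain f t A = \int[mu]_(x in A) (t - f x).
Proof.
move=> intf mA; rewrite RintegralB//; first by rewrite Rintegral_cst.
- exact: finite_measure_integrable_cst.
- exact: integrableS intf.
Qed.

(** The gain is the integral of t - f over A, and the sublevel set consists of the points where this
    integrand is nonnegative. *)
Lemma gain_le_sublevel (f : X -> R) (t : R) (A : set X) :
  mu.-integrable [set: X] (EFin \o f) -> measurable A ->
  gain f t A <= gain f t [set x | f x <= t].
Proof.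
move=> intf mA.
have mP : measurable [set x | f x <= t].
  exact/measurable_sublevel/integrable_measurable.
have intg : mu.-integrable [set: X] (EFin \o (fun x => t - f x)).
  have intt : mu.-integrable [set: X] (EFin \o cst t).
    exact: finite_measure_integrable_cst.
  exact: (integrableB measurableT intt intf).
rewrite !gainE// Rintegral_mkcond [leRHS]Rintegral_mkcond.
apply: le_Rintegral => //=.
- rewrite -restrict_EFin -integrable_mkcond//.
  exact: integrableS intg.
- rewrite -restrict_EFin -integrable_mkcond//.
  exact: integrableS intg.
move=> x _; rewrite !patchE.
case: ifPn => _; case: ifPn => //; rewrite ?inE ?notin_setE /= => xP.
- by rewrite subr_le0 ltW// ltNge; apply/negP.
- by rewrite subr_ge0.
Qed.

(** Each sublevel set competes at the level of the other one; on a fixed set A, passing from level s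
    to t changes the gain by (t - s) mu A. *)
Lemma gain_sublevel_slope (f : X -> R) (s t : R) :
  mu.-integrable [set: X] (EFin \o f) ->
  (t - s) * fine (mu [set x | f x <= s]) <=
    gain f t [set x | f x <= t] - gain f s [set x | f x <= s] <=
    (t - s) * fine (mu [set x | f x <= t]).
Proof.
move=> intf.
have mP r : measurable [set x | f x <= r].
  exact/measurable_sublevel/integrable_measurable.
have h1 := gain_le_sublevel f t _ intf (mP s).
have h2 := gain_le_sublevel f s _ intf (mP t).
by rewrite /gain in h1 h2 *; apply/andP; split; lra.
Qed.

(** Every pair (mu A, integral of [f1] over A) lies in the closure of the corresponding pairs for
    [f2]. *)
Definition approximable (f1 f2 : X -> R) := forall (eps : R) (A : set X),
  0 < eps -> measurable A -> exists B : set X,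
  [/\ measurable B, `|fine (mu A) - fine (mu B)| <= eps &
      `|\int[mu]_(x in A) f1 x - \int[mu]_(x in B) f2 x| <= eps].

Lemma approximable_gain_le (f1 f2 : X -> R) (t : R) :
  mu.-integrable [set: X] (EFin \o f1) ->
  mu.-integrable [set: X] (EFin \o f2) ->
  approximable f1 f2 ->
  gain f1 t [set x | f1 x <= t] <= gain f2 t [set x | f2 x <= t].
Proof.
move=> int1 int2 f12; apply/ler_addgt0Pr => e e0.
have t1 : 0 < `|t| + 1 by rewrite ltr_wpDl.
have mA : measurable [set x | f1 x <= t].
  exact/measurable_sublevel/integrable_measurable.
(* Errors of at most delta in both coordinates change the gain at t by at most ([|t|] + 1) delta,
   whence this tolerance. *)
have [B [mB muB intB]] := f12 _ _ (divr_gt0 e0 t1) mA.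
rewrite -lerBlDr; apply: le_trans (gain_le_sublevel f2 t B int2 mB).
rewrite lerBlDr /gain -[e in leRHS](@divfK _ (`|t| + 1)) ?gt_eqF//.
rewrite mulrDr mulr1 -lerBlDl.
set I1 := \int[mu]_(x in _) f1 x in intB *.
set I2 := \int[mu]_(x in _) f2 x in intB *.
have : t * (fine (mu [set x | f1 x <= t]) - fine (mu B)) <=
       e / (`|t| + 1) * `|t|.
  apply: le_trans (ler_norm _) _; rewrite normrM mulrC.
  exact: ler_wpM2r.
by move: intB; rewrite ler_norml => /andP[]; lra.
Qed.

(** Both functions have the same E, so for t > r the slope of E on [r, t] is at least [cdf f1 r] and
    at most [cdf f2 t]. Right continuity of [cdf f2] concludes as t decreases to r. *)
Lemma approximable_cdf_le (f1 f2 : {RV mu >-> R}) (r : R) :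
  mu.-integrable [set: X] (EFin \o f1) ->
  mu.-integrable [set: X] (EFin \o f2) ->
  approximable f1 f2 -> approximable f2 f1 ->
  (cdf f1 r <= cdf f2 r)%E.
Proof.
move=> int1 int2 f12 f21.
have EE s : gain f1 s [set x | f1 x <= s] = gain f2 s [set x | f2 x <= s].
  by apply/eqP; rewrite eq_le !approximable_gain_le.
have cdfE (f : {RV mu >-> R}) s : cdf f s = mu [set x | f x <= s].
  by rewrite -preimage_itvNyc.
have rc : cdf f2 t @[t --> r^'+] --> cdf f2 r.
  exact: (@cdf_right_continuous _ _ _ _ f2 r).
rewrite -(cvg_lim _ rc)//; apply: lime_ge.
  by apply/cvg_ex; eexists; exact: rc.
near=> t.
have rt : 0 < t - r by rewrite subr_gt0; near: t; exact: nbhs_right_gt.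
rewrite !cdfE -[leLHS]fineK ?fin_num_measure//; last exact: measurable_sublevel.
rewrite -[leRHS]fineK ?fin_num_measure//; last exact: measurable_sublevel.
rewrite lee_fin -(ler_pM2l rt).
have /andP[h1 _] := gain_sublevel_slope f1 r t int1.
have /andP[_ h2] := gain_sublevel_slope f2 r t int2.
by rewrite !EE in h1; exact: le_trans h1 h2.
Unshelve. all: end_near. Qed.

Lemma approximable_distribution (f1 f2 : {RV mu >-> R}) (A : set R) :
  mu.-integrable [set: X] (EFin \o f1) ->
  mu.-integrable [set: X] (EFin \o f2) ->
  approximable f1 f2 -> approximable f2 f1 -> measurable A ->
  distribution mu f1 A = distribution mu f2 A.
Proof.
move=> int1 int2 f12 f21 mA.
have cdf12 r : distribution mu f1 `]-oo, r] = distribution mu f2 `]-oo, r].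
  by apply/eqP; rewrite eq_le; apply/andP; split; exact: approximable_cdf_le.
(* The generating pi-system is that of the open upper rays, complements of the rays measured by the
   cdf; those starting at -n exhaust the line. *)
apply: (measure_unique (@RGenOInfty.G R)
  (fun n => `]- n%:R, +oo[%classic)) => //.
- exact: RGenOInfty.measurableE.
- move=> _ _ [x ->] [y ->]; exists (Num.max x y).
  by apply/seteqP; split => z /=; rewrite !in_itv/= !andbT gt_max => /andP.
- by move=> n; exists (- n%:R).
- apply/seteqP; split => // x _; exists (Num.truncn `|x|).+1 => //=.
  rewrite in_itv/= andbT ltrNl (le_lt_trans _ (truncnS_gt _))//.
  by rewrite -normrN ler_norm.
- move=> _ [x ->]; rewrite -setCitvl.
  have setC (f : {RV mu >-> R}) : distribution mu f (~` `]-oo, x]) =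
      (1 - distribution mu f `]-oo, x])%E by exact: probability_setC.
  by rewrite /= !setC cdf12.
- by move=> n; rewrite (le_lt_trans (probability_le1 _ _)) ?ltry.
Qed.

(** Since h(f) may fail to be integrable, equality in law is transferred to its positive and
    negative parts separately. *)
Lemma approximable_integral (f1 f2 : X -> R) (h : R -> R) :
  mu.-integrable [set: X] (EFin \o f1) ->
  mu.-integrable [set: X] (EFin \o f2) ->
  approximable f1 f2 -> approximable f2 f1 -> measurable_fun [set: R] h ->
  (\int[mu]_x (h (f1 x))%:E = \int[mu]_x (h (f2 x))%:E)%E.
Proof.
move=> int1 int2 f12 f21 mh.
have mf1 : measurable_fun [set: X] f1.
  exact: integrable_measurable.
have mf2 : measurable_fun [set: X] f2.
  exact: integrable_measurable.
pose Y1 : {RV mu >-> R} := mfun_Sub (mem_set mf1).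
pose Y2 : {RV mu >-> R} := mfun_Sub (mem_set mf2).
have law (k : R -> \bar R) :
    measurable_fun [set: R] k -> (forall y, 0 <= k y)%E ->
    (\int[mu]_x k (f1 x) = \int[mu]_x k (f2 x))%E.
  move=> mk k0.
  rewrite -(ge0_integral_distribution Y1 mk k0).
  rewrite -(ge0_integral_distribution Y2 mk k0).
  apply: eq_measure_integral => A mA _.
  exact: approximable_distribution.
have mk : measurable_fun [set: R] (EFin \o h) by exact/measurable_EFinP.
have posneg (f : X -> R) : (\int[mu]_x (h (f x))%:E =
    \int[mu]_x (EFin \o h)^\+ (f x) - \int[mu]_x (EFin \o h)^\- (f x))%E.
  rewrite integralE -[fun x => (h (f x))%:E]/((EFin \o h) \o f).
  by rewrite funepos_comp funeneg_comp.
rewrite !posneg; congr (_ - _)%E.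
- apply: (law ((EFin \o h)^\+)%E); [exact: measurable_funepos|].
  exact: funepos_ge0.
- apply: (law ((EFin \o h)^\-)%E); [exact: measurable_funeneg|].
  exact: funeneg_ge0.
Qed.

End equality_in_law.
Arguments approximable {d X R} mu f1 f2.

(** * Densities of translated measures under weak containment *)

Section density.
Context (G : groupType) d (X : measurableType d) (R : realType).
Variable mu : probability X R.

Definition density (a : mact G X) (g : G) (x : X) : R :=
  fine (Radon_Nikodym (gmu mu a g) mu x).

Section quasi_invariant.
Variables (a : mact G X) (g : G).
Hypothesis qi : forall A, measurable A -> (mu (a g @` A) = 0 <-> mu A = 0)%E.

Lemma gmu_dominates : gmu mu a g `<< mu.
Proof. by apply/null_content_dominatesP => A mA /(qi A mA). Qed.

(** The chosen derivative is finite at every point, so [fine] loses nothing. *)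
Lemma EFin_density :
  EFin \o density a g = Radon_Nikodym (gmu mu a g) mu.
Proof.
apply/funext => x /=; rewrite fineK//.
exact: Radon_Nikodym_fin_num gmu_dominates.
Qed.

Lemma integrable_density : mu.-integrable [set: X] (EFin \o density a g).
Proof.
by rewrite EFin_density; exact: Radon_Nikodym_integrable gmu_dominates.
Qed.

Lemma Rintegral_density (A : set X) : measurable A ->
  \int[mu]_(x in A) density a g x = fine (mu (a g @` A)).
Proof.
move=> mA; rewrite /Rintegral -[mu (a g @` A)]/(gmu mu a g A).
rewrite (Radon_Nikodym_integral gmu_dominates)//; congr fine.
by apply: eq_integral => x _; rewrite -EFin_density.
Qed.

End quasi_invariant.

Lemma weakly_contained_approximable (a b : mact G X) (g : G) :
  (forall A, measurable A -> (mu (a g @` A) = 0 <-> mu A = 0)%E) ->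
  (forall A, measurable A -> (mu (b g @` A) = 0 <-> mu A = 0)%E) ->
  weakly_contained mu a b -> approximable mu (density a g) (density b g).
Proof.
move=> qa qb ab e A e0 mA.
have e20 : 0 < e / 2 by rewrite divr_gt0.
pose S (i : 'I_2) := if i == 0 then A else [set: X].
have mS i : measurable (S i) by rewrite /S; case: ifP.
(* The image of A enters weak containment only through intersections, hence the
   whole space as a second set; g = 1 then controls the measures themselves. *)
have [B [mB /= AB]] := ab (e / 2) e20 [:: 1%g; g] 2%N S mS.
have act1E (c : mact G X) C : c 1%g @` C = C.
  rewrite -[RHS]image_id; congr image; apply/funext => x.
  exact: act1.
have finm (C : set X) : measurable C -> mu C \is a fin_num.
  exact: fin_num_measure.
have mg (c : mact G X) C : measurable C -> measurable (c g @` C).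
  exact: measurable_act_image.
have dist (C D : set X) : measurable C -> measurable D ->
    (`| mu C - mu D | < (e / 2)%:E)%E -> `|fine (mu C) - fine (mu D)| < e / 2.
  by move=> mC mD; rewrite -(fineK (finm _ mC)) -(fineK (finm _ mD)).
have h0 : `|fine (mu A) - fine (mu (B 0))| < e / 2.
  apply: dist => //; have := AB 1%g 0 0.
  by rewrite !act1E !setIid /S/= inE eqxx; apply.
have h1 : `|fine (mu [set: X]) - fine (mu (B 1))| < e / 2.
  apply: dist => //; have := AB 1%g 1 1.
  by rewrite !act1E !setIid /S/= inE eqxx; apply.
have hg : `|fine (mu (a g @` A)) - fine (mu (b g @` B 0 `&` B 1))| < e / 2.
  apply: dist; [exact: mg|by apply: measurableI => //; exact: mg|].
  have := AB g 0 1.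
  by rewrite /S/= setIT !inE eqxx orbT; apply.
exists (B 0); split => //.
  by apply/ltW/(lt_trans h0); lra.
rewrite !Rintegral_density//.
have mgB := mg b _ (mB 0).
have mI := measurableI _ _ mgB (mB 1).
(* By [h1], [B 1] misses a set of measure less than e / 2, so removing the intersection with [B 1]
   costs less than e / 2; [hg] accounts for the other half. *)
have le1 : fine (mu (b g @` B 0 `&` B 1)) <= fine (mu (b g @` B 0)).
  apply: fine_le; [exact: finm|exact: finm|].
  by apply: le_measure; rewrite ?inE// => x [].
have le2 : fine (mu (b g @` B 0)) <=
    fine (mu (b g @` B 0 `&` B 1)) + (1 - fine (mu (B 1))).
  have mD := measurableD mgB (mB 1).
  have mC := measurableC (mB 1).
  rewrite (measureDI mu mgB (mB 1)) (fineD (finm _ mD) (finm _ mI)) addrC lerD2l.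
  have <- : fine (mu (~` B 1)) = 1 - fine (mu (B 1)).
    by rewrite probability_setC// fineB ?finm.
  apply: fine_le; [exact: finm|exact: finm|].
  by apply: le_measure; rewrite ?inE// => x [].
move: h1 hg; rewrite probability_setT/= !ltr_norml ler_norml.
by move=> /andP[? ?] /andP[? ?]; lra.
Qed.

End density.
Arguments density {G d X R} mu a g x.

Theorem theorem1 (G : groupType) (R : realType) (m : G -> R)
    (d : measure_display) (X : measurableType d) (mu : probability X R)
    (a b : mact G X) :
  countable [set: G] ->
  prob_on m ->
  standard_borel R X ->
  stationary m mu a -> stationary m mu b ->
  weakly_equiv mu a b ->
  furstenberg_entropy m mu a = furstenberg_entropy m mu b.
Proof.
move=> _ _ _ [qa _] [qb _] [ab ba].
apply: eq_esum => g _; congr (_ * - _)%E.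
(* Here h is [ln], a total function with value 0 at nonpositive numbers, hence measurable on the
   whole line. *)
apply: (@approximable_integral _ _ _ _ (density mu a g) (density mu b g)).
- exact/integrable_density/qa.
- exact/integrable_density/qb.
- by apply: weakly_contained_approximable => //; [exact: qa|exact: qb].
- by apply: weakly_contained_approximable => //; [exact: qb|exact: qa].
- exact: measurable_ln.
Qed.
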